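(* Let $T,k\in\mathbb{N}$ and let $w\in\{0,1\}^T$ be a random variable satisfying the $\epsilon$-martingale condition. Decompose $w=xy$ with $|y|=k$. Then \[ \Pr[\text{there is an } x\text{-balanced fork for } xy] = \Pr[\mu_x(y)\ge 0]\le \exp(-\Omega(k)), \] where the asymptotic notation hides constants depending only on $\epsilon$.
   Context: Characteristic strings and forks. A characteristic string is $w=w_1\dots w_n\in\{0,1\}^n$; index $i$ is honest if $w_i=0$ and adversarial if $w_i=1$. A fork for $w$ is a rooted tree $F$ with edges directed away from the root $r$ and labeling $\ell:V\to\{0,\dots,n\}$ with (F1) $\ell(r)=0$; (F2) labels strictly increasing along directed paths; (F3) each honest index labels exactly one vertex; (F4) for honest $i<j$ the vertex labeled $i$ has strictly smaller depth than the vertex labeled $j$. Write $F\vdash w$. A vertex is honest if it is the root or labeled by an honest index. A tine is a directed path from the root; its length is its number of edges, $\ell(t)$ the label of its last vertex; $\mathrm{height}(F)$ is the maximal tine length. A fork is closed if every leaf is honest (the single-vertex fork is closed); a closed fork has a unique longest tine $\hat t$. Reach and relative margin. For closed $F\vdash w$ and tine $t$: $\mathrm{gap}(t)=\mathrm{length}(\hat t)-\mathrm{length}(t)$, $\mathrm{reserve}(t)=|\{i: w_i=1,\ i>\ell(t)\}|$, $\mathrm{reach}(t)=\mathrm{reserve}(t)-\mathrm{gap}(t)$. For $w=xy$, tines $t_1,t_2$ are disjoint over $y$ (written $t_1\not\sim_x t_2$) if they share no edge terminating at a vertex whose label is an index of $y$ (label $>|x|$); a tine may be paired with itself. $\mu_x(F)=\max_{t_1\not\sim_x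 t_2}\min\{\mathrm{reach}(t_1),\mathrm{reach}(t_2)\}$ and $\mu_x(y)=\max\{\mu_x(F): F\vdash xy \text{ closed}\}$. A fork $F\vdash xy$ is $x$-balanced if it contains tines $t_1\not\sim_x t_2$ with $\mathrm{length}(t_1)=\mathrm{length}(t_2)=\mathrm{height}(F)$. A random variable $W\in\{0,1\}^n$ satisfies the $\epsilon$-martingale condition ($\epsilon\in(0,1)$) if for every $t$, $\Pr[W_t=1\mid W_1,\dots,W_{t-1}]\le(1-\epsilon)/2$. *)

(* Defs.v *)
From HB Require Import structures.
From mathcomp Require Import all_boot all_order all_algebra.
From mathcomp Require Import boolp reals.
From mathcomp Require Import sequences exp.
Set Implicit Arguments. Unset Strict Implicit. Unset Printing Implicit Defensive.
Import Order.TTheory GRing.Theory Num.Theory.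

(* Characteristic strings: w : seq bool, w_i = nth false w i.-1 (1-based);
   true = adversarial (1), false = honest (0). *)
Definition adv_index (w : seq bool) (i : nat) : bool :=
  (0 < i <= size w) && nth false w i.-1.
Definition hon_index (w : seq bool) (i : nat) : bool :=
  (0 < i <= size w) && ~~ nth false w i.-1.

(* A fork: vertices 0..fsz, root 0, parent function fpar (with fpar v < v
   for non-root vertices, a topological numbering), labeling flab. *)
Record fork := Fork { fsz : nat; fpar : nat -> nat; flab : nat -> nat }.

Section ForkDefs.
Variable F : fork.

Fixpoint depth_aux (fuel v : nat) : nat :=
  match fuel with
  | 0 => 0
  | f.+1 => if v == 0 then 0 else (depth_aux f (fpar F v)).+1
  end.
Definition depth (v : nat) : nat := depth_aux v v.

Fixpoint anc_aux (fuel v : nat) : seq nat :=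
  match fuel with
  | 0 => [:: v]
  | f.+1 => if v == 0 then [:: 0] else v :: anc_aux f (fpar F v)
  end.
Definition anc (v : nat) : seq nat := anc_aux v v.

Definition height : nat := \max_(v < (fsz F).+1) depth v.

Definition is_leaf (v : nat) : bool :=
  (v <= fsz F) && ~~ has (fun u => fpar F u == v) (iota 1 (fsz F)).

End ForkDefs.

Definition is_fork (w : seq bool) (F : fork) : Prop :=
  [/\ flab F 0 = 0,
      (forall v, 0 < v <= fsz F ->
         [/\ fpar F v < v, flab F (fpar F v) < flab F v & flab F v <= size w]),
      (forall i, hon_index w i ->
         count (fun v => flab F v == i) (iota 0 (fsz F).+1) = 1) &
      (forall u v, u <= fsz F -> v <= fsz F ->
         hon_index w (flab F u) -> hon_index w (flab F v) ->
         flab F u < flab F v -> depth F u < depth F v)].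

Definition honest_vertex (w : seq bool) (F : fork) (v : nat) : bool :=
  (v == 0) || hon_index w (flab F v).

Definition closed_fork (w : seq bool) (F : fork) : Prop :=
  is_fork w F /\ forall v, is_leaf F v -> honest_vertex w F v.

Local Open Scope ring_scope.

Definition reserve (w : seq bool) (F : fork) (v : nat) : nat :=
  count (fun i => adv_index w i && (flab F v < i)%N) (iota 1 (size w)).
Definition gap (F : fork) (v : nat) : int :=
  (height F)%:Z - (depth F v)%:Z.
Definition reach (w : seq bool) (F : fork) (v : nat) : int :=
  (reserve w F v)%:Z - gap F v.

(* tines ending at u and v are disjoint over y, where |x| = m: they share
   no edge terminating at a vertex with label > m (edges of a tine are
   identified with their terminal, non-root, vertices). *)
Definition disjoint_over (m : nat) (F : fork) (u v : nat) : bool :=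
  ~~ has (fun z => (m < flab F z)%N && (z \in anc F v)) (anc F u).

(* mu_x(F), |x| = m : the max over disjoint pairs of min of reaches
   (the pair (root, root) is always disjoint, so the initial value
   reach root is itself attained). *)
Definition mu_fork (m : nat) (w : seq bool) (F : fork) : int :=
  foldr (fun p acc => Num.max (Num.min (reach w F p.1) (reach w F p.2)) acc)
        (reach w F 0)
        [seq p <- [seq (u, v) | u <- iota 0 (fsz F).+1, v <- iota 0 (fsz F).+1]
           | disjoint_over m F p.1 p.2].

(* mu_x(y) >= 0, where mu_x(y) = max over closed F |- xy of mu_x(F) *)
Definition mu_rel_nonneg (x y : seq bool) : Prop :=
  exists F, closed_fork (x ++ y) F /\ 0 <= mu_fork (size x) (x ++ y) F.

Definition has_balanced_fork (x y : seq bool) : Prop :=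
  exists F, is_fork (x ++ y) F /\
    exists u v, [/\ (u <= fsz F)%N, (v <= fsz F)%N, disjoint_over (size x) F u v,
                    depth F u = height F & depth F v = height F].

Definition is_distribution (R : realType) (T : nat) (p : T.-tuple bool -> R) : Prop :=
  (forall w, 0 <= p w) /\ \sum_(w : T.-tuple bool) p w = 1.

Definition Pr (R : realType) (T : nat) (p : T.-tuple bool -> R)
    (E : T.-tuple bool -> Prop) : R :=
  \sum_(w : T.-tuple bool | `[< E w >]) p w.

(* eps-martingale condition: for each position t (0-based here) and each
   prefix s of length t, Pr[W_t = 1 /\ prefix = s] <= (1-eps)/2 Pr[prefix = s]
   (the conditional-probability bound, vacuous on null prefixes). *)
Definition martingale_cond (R : realType) (eps : R) (T : nat)
    (p : T.-tuple bool -> R) : Prop :=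
  forall (t : nat) (s : seq bool), (t < T)%N -> size s = t ->
    \sum_(w : T.-tuple bool | (take t w == s) && nth false w t) p w
      <= (1 - eps) / 2 * \sum_(w : T.-tuple bool | take t w == s) p w.

(* Main.v *)
(** Both events say that some fork has two tines of nonnegative reach that are
    disjoint over y: removing an adversarial leaf (and retreating to its parent)
    never decreases reach and eventually closes the fork, while extending a tine
    by an adversarial vertex at the next adversarial index preserves reach until
    the tine has full length.

    Following a fork through the prefixes of w bounds every reach by rho, where
    rho goes up on 1 and down to at least 0 on 0, and every pair of tines
    disjoint over y by mu, which starts at rho(x) and moves with w, except that
    it stays at 0 on a 0 read while rho > 0 = mu.  Only these upper bounds on
    the paper's recurrences are needed.  For b = 1 / (1 - eps) and a > 1 close
    to 1, the expectation of a ^ rho * b ^ min(mu, 0) contracts at each step by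
    a factor at most 1 - eps^3 / 4, starting from E[a ^ rho(x)] = O(1), and the quantity
    is at least 1 when mu >= 0. *)
Require Import Defs.
From HB Require Import structures.
From mathcomp Require Import all_boot all_order all_algebra.
From mathcomp Require Import boolp reals.
From mathcomp Require Import sequences exp.
From mathcomp Require Import zify ring lra.
Import Order.TTheory GRing.Theory Num.Theory.
Local Open Scope ring_scope.
Set Implicit Arguments. Unset Strict Implicit. Unset Printing Implicit Defensive.

(** * Ancestors, labels and reach *)

Section Ancestors.
Local Open Scope nat_scope.
Variable F : fork.
Hypothesis par_lt : forall v, 0 < v <= fsz F -> fpar F v < v.

(** Parents have smaller numbers, so fuel [v] always suffices to reach the root; this yields the
    plain recursions on parents. *)
Lemma depth_aux_fuel f g v : v <= f -> v <= g -> v <= fsz F ->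
  depth_aux F f v = depth_aux F g v.
Proof.
elim: f g v => [|f IH] [|g] [|v] //= vf vg vF.
have := @par_lt v.+1 vF => p_lt.
by congr _.+1; apply: IH; lia.
Qed.

Lemma anc_aux_fuel f g v : v <= f -> v <= g -> v <= fsz F ->
  anc_aux F f v = anc_aux F g v.
Proof.
elim: f g v => [|f IH] [|g] [|v] //= vf vg vF.
have := @par_lt v.+1 vF => p_lt.
by congr cons; apply: IH; lia.
Qed.

Lemma depth_par v : 0 < v <= fsz F -> depth F v = (depth F (fpar F v)).+1.
Proof.
case: v => [//|v] vF; have p_lt := @par_lt v.+1 vF.
by rewrite /depth /=; congr _.+1; apply: depth_aux_fuel; lia.
Qed.

Lemma anc_par v : 0 < v <= fsz F -> anc F v = v :: anc F (fpar F v).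
Proof.
case: v => [//|v] vF; have p_lt := @par_lt v.+1 vF.
by rewrite /anc /=; congr cons; apply: anc_aux_fuel; lia.
Qed.

Lemma anc_refl v : v <= fsz F -> v \in anc F v.
Proof.
case: v => [|v] vF; first by rewrite /anc /= inE.
by rewrite anc_par ?mem_head.
Qed.

Lemma sub_anc_par v : 0 < v <= fsz F -> {subset anc F (fpar F v) <= anc F v}.
Proof. by move=> vF c; rewrite (anc_par vF) inE => ->; rewrite orbT. Qed.

Lemma anc_le v c : v <= fsz F -> c \in anc F v -> c <= v.
Proof.
elim/ltn_ind: v => -[|v] IH vF; first by rewrite /anc /= inE => /eqP ->.
have p_lt := @par_lt v.+1 vF.
rewrite anc_par // inE => /orP[/eqP -> //|/IH]; lia.
Qed.

End Ancestors.

Section Basics.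
Local Open Scope nat_scope.

Lemma fork_par_lt w F : is_fork w F -> forall v, 0 < v <= fsz F -> fpar F v < v.
Proof. by case=> _ H _ _ v /H[]. Qed.

Lemma disjoint_overP m F u v :
  reflect (forall c, c \in anc F u -> c \in anc F v -> flab F c <= m)
    (disjoint_over m F u v).
Proof.
apply: (iffP hasPn) => H c cu.
  by move=> cv; move: (H c cu); rewrite cv andbT -leqNgt.
by apply/negP => /andP[lt cv]; move: (H c cu cv); rewrite leqNgt lt.
Qed.

Lemma disjoint_overC m F u v : disjoint_over m F u v = disjoint_over m F v u.
Proof. by apply/disjoint_overP/disjoint_overP => H c cu cv; apply: H. Qed.

Lemma depth_le_height F v : v <= fsz F -> depth F v <= height F.
Proof.
by move=> vF; have := leq_bigmax (F := fun i : 'I__ => depth F i) (Ordinal (vF : v < (fsz F).+1)).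
Qed.

Lemma height_leP F b :
  (forall v, v <= fsz F -> depth F v <= b) -> height F <= b.
Proof. by move=> H; apply/bigmax_leqP => v _; apply: H; rewrite -ltnS. Qed.

Lemma adv_or_hon w i : 0 < i <= size w -> adv_index w i = ~~ hon_index w i.
Proof. by rewrite /adv_index /hon_index => ->; case: nth. Qed.

Lemma flab_le w F v : is_fork w F -> v <= fsz F -> flab F v <= size w.
Proof.
case=> H0 H1 _ _; case: v => [|v] vF; first by rewrite H0.
by case: (@H1 v.+1 vF).
Qed.

Lemma hon_label_inj w F u v : is_fork w F -> u <= fsz F -> v <= fsz F ->
  hon_index w (flab F u) -> flab F v = flab F u -> u = v.
Proof.
case=> _ _ H2 _ uF vF hu e; move: (H2 _ hu).
rewrite -size_filter; case E: filter => [|a [|b s]] // _.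
have /[!inE]/eqP-> : u \in [:: a] by rewrite -E mem_filter eqxx mem_iota.
have /[!inE]/eqP-> // : v \in [:: a] by rewrite -E mem_filter e eqxx mem_iota.
Qed.

End Basics.

(** The meeting point of the two events: it asks neither for a closed fork nor for tines of full
    length. *)
Definition reach_pair m w F u v :=
  [/\ (u <= fsz F)%N, (v <= fsz F)%N, disjoint_over m F u v,
      0 <= reach w F u & 0 <= reach w F v].

Lemma reach_pairC m w F u v : reach_pair m w F u v -> reach_pair m w F v u.
Proof. by case=> *; split=> //; rewrite disjoint_overC. Qed.

Lemma foldr_max_ge0 (T : eqType) (f : T -> int) x0 (s : seq T) :
  0 <= foldr (fun p acc => Num.max (f p) acc) x0 s <->
  0 <= x0 \/ exists2 p, p \in s & 0 <= f p.
Proof.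
elim: s => [|a s IH] /=; first by split=> [|[|[]]] //; left.
rewrite le_max; split=> [/orP[fa|/IH[x0_ge0|[p ps fp]]]|[x0_ge0|[p]]].
- by right; exists a => //; rewrite mem_head.
- by left.
- by right; exists p => //; rewrite inE ps orbT.
- by apply/orP; right; apply/IH; left.
- rewrite inE => /orP[/eqP-> ->//|ps fp].
  by apply/orP; right; apply/IH; right; exists p.
Qed.

Lemma mu_fork_ge0P m w F : is_fork w F ->
  0 <= mu_fork m w F <-> exists u v, reach_pair m w F u v.
Proof.
move=> [H0 _ _ _]; rewrite /mu_fork foldr_max_ge0; split.
  case=> [r0|[[u v]]].
    (* The initial value of the fold is attained by the pair (root, root), whose only common vertex
       has label 0. *)
    exists 0%N, 0%N; split=> //; apply/disjoint_overP => c.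
    by rewrite /anc /= inE => /eqP-> _; rewrite H0.
  rewrite mem_filter le_min => /andP[uv /allpairsPdep[u' [v' []]]].
  rewrite !mem_iota !add0n !ltnS => uF vF [eu ev] /andP[ru rv].
  by exists u, v; rewrite eu ev in uv ru rv *; split.
case=> u [v [uF vF uv ru rv]]; right; exists (u, v); last by rewrite le_min ru.
by rewrite mem_filter uv; apply: allpairs_f_dep; rewrite mem_iota.
Qed.

Definition adv_upto (w : seq bool) (n : nat) : nat := count (adv_index w) (iota 1 n).

Lemma adv_uptoS w n : adv_upto w n.+1 = (adv_upto w n + adv_index w n.+1)%N.
Proof. by rewrite /adv_upto -{1}[n.+1]addn1 iotaD count_cat /= addn0 add1n. Qed.

Lemma adv_upto_le w m n : (m <= n)%N -> (adv_upto w m <= adv_upto w n)%N.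
Proof. by move=> mn; rewrite /adv_upto -(subnKC mn) iotaD count_cat leq_addr. Qed.

Lemma reserve_adv_upto w F v : (flab F v <= size w)%N ->
  (reserve w F v + adv_upto w (flab F v) = adv_upto w (size w))%N.
Proof.
move=> le; rewrite /reserve /adv_upto -(subnKC le) iotaD !count_cat.
rewrite [X in (X + _ + _)%N](_ : _ = 0%N); last first.
  apply/eqP; rewrite -leqn0 leqNgt -has_count -all_predC; apply/allP => i.
  by rewrite mem_iota /=; lia.
rewrite add0n addnC; congr (_ + _)%N; apply: eq_in_count => i.
by rewrite mem_iota; lia.
Qed.

(** Retreating costs one edge, but the adversarial label of the dropped vertex joins the reserve and
    makes up for it. *)
Lemma reach_par w F v : is_fork w F -> (0 < v <= fsz F)%N ->
  adv_index w (flab F v) -> reach w F v <= reach w F (fpar F v).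
Proof.
move=> fF vF advv; have [_ /(_ v vF)[_ lt le] _ _] := fF.
have d := depth_par (fork_par_lt fF) vF.
have e1 := reserve_adv_upto le.
have e2 := reserve_adv_upto (leq_trans (ltnW lt) le).
have lt1 : (flab F (fpar F v) <= (flab F v).-1)%N by lia.
have := adv_upto_le w lt1.
have := adv_uptoS w (flab F v).-1; rewrite prednK ?advv; last by lia.
by rewrite /reach /gap d; lia.
Qed.

(** * Extending a tine by an adversarial vertex *)

(** The new vertex takes the next free number, so old vertices keep theirs and parents still precede
    children. *)
Definition add_leaf (F : fork) (u l : nat) : fork :=
  Fork (fsz F).+1 (fun v => if v == (fsz F).+1 then u else fpar F v)
       (fun v => if v == (fsz F).+1 then l else flab F v).

Section AddLeaf.
Local Open Scope nat_scope.
Variables (w : seq bool) (F : fork) (u l : nat).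
Hypotheses (forkF : is_fork w F) (uF : u <= fsz F).
Local Notation F' := (add_leaf F u l).
Local Notation z := (fsz F).+1.

Lemma add_leaf_par_lt v : 0 < v <= fsz F' -> fpar F' v < v.
Proof.
rewrite /=; case: eqP => [->|ne] vF; first by rewrite ltnS.
by apply: (fork_par_lt forkF); lia.
Qed.

Lemma add_leaf_flab v : v <= fsz F -> flab F' v = flab F v.
Proof. by rewrite /= => vF; case: eqP => //; lia. Qed.

Lemma add_leaf_flab_new : flab F' z = l.
Proof. by rewrite /= eqxx. Qed.

Lemma add_leaf_fpar v : v <= fsz F -> fpar F' v = fpar F v.
Proof. by rewrite /= => vF; case: eqP => //; lia. Qed.

Lemma add_leaf_depth v : v <= fsz F -> depth F' v = depth F v.
Proof.
elim/ltn_ind: v => -[|v] IH vF //.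
have vF' : 0 < v.+1 <= fsz F' by rewrite /=; lia.
rewrite (depth_par add_leaf_par_lt) // (depth_par (fork_par_lt forkF)) //.
have p_lt := fork_par_lt forkF (vF : 0 < v.+1 <= fsz F).
by rewrite add_leaf_fpar // IH //; lia.
Qed.

Lemma add_leaf_anc v : v <= fsz F -> anc F' v = anc F v.
Proof.
elim/ltn_ind: v => -[|v] IH vF //.
have vF' : 0 < v.+1 <= fsz F' by rewrite /=; lia.
rewrite (anc_par add_leaf_par_lt) // (anc_par (fork_par_lt forkF)) //.
have p_lt := fork_par_lt forkF (vF : 0 < v.+1 <= fsz F).
by rewrite add_leaf_fpar // IH //; lia.
Qed.

Lemma add_leaf_depth_new : depth F' z = (depth F u).+1.
Proof.
rewrite (depth_par add_leaf_par_lt) ?leqnn //.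
by rewrite /= eqxx add_leaf_depth.
Qed.

Lemma add_leaf_anc_new : anc F' z = z :: anc F u.
Proof.
rewrite (anc_par add_leaf_par_lt) ?leqnn //.
by rewrite /= eqxx add_leaf_anc.
Qed.

Lemma add_leaf_fork : flab F u < l -> adv_index w l -> is_fork w F'.
Proof.
move=> ul advl; case: (forkF) => H0 H1 H2 H3.
have nhonl : hon_index w l = false.
  by apply/negbTE; rewrite -adv_or_hon //; case/andP: advl.
split.
- by rewrite add_leaf_flab.
- move=> v; rewrite [fsz _]/= => vF.
  case: (eqVneq v z) => [->|vz].
    rewrite add_leaf_flab_new /= eqxx ltnS; case: eqP => [|_]; first lia.
    by split=> //; case/andP: advl => /andP[].
  have vF' : 0 < v <= fsz F by lia.
  have p_lt := fork_par_lt forkF vF'.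
  by rewrite add_leaf_fpar ?add_leaf_flab; [apply: H1 | lia..].
- move=> i hi; rewrite [fsz _]/= -[(fsz F).+2]addn1 iotaD -/(iota 0 z) count_cat.
  rewrite [iota (0 + _) 1]/= [count _ [:: _]]/= eqxx !addn0.
  have /negbTE-> : l != i by apply/eqP => e; rewrite e hi in nhonl.
  rewrite addn0 -[RHS](H2 i hi); apply: eq_in_count => v; rewrite mem_iota => vF.
  by rewrite add_leaf_flab.
- move=> a b aF bF; case: (eqVneq a z) => [->|az]; first by rewrite add_leaf_flab_new nhonl.
  case: (eqVneq b z) => [->|bz]; first by rewrite add_leaf_flab_new nhonl.
  have aF' : a <= fsz F by move: aF az; rewrite /=; lia.
  have bF' : b <= fsz F by move: bF bz; rewrite /=; lia.
  by rewrite !add_leaf_depth // !add_leaf_flab //; apply: H3.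
Qed.

Lemma add_leaf_height : depth F u < height F -> height F' = height F.
Proof.
move=> lt; apply/eqP; rewrite eqn_leq; apply/andP; split; apply: height_leP => v vF.
  case: (eqVneq v z) => [->|vz]; first by rewrite add_leaf_depth_new.
  by rewrite add_leaf_depth ?depth_le_height //; move: vF vz; rewrite /=; lia.
by rewrite -add_leaf_depth // depth_le_height // /=; lia.
Qed.

End AddLeaf.

(** Taking the least adversarial index beyond the label uses up a single unit of reserve. *)
Lemma next_adv_index w F u : (0 < reserve w F u)%N ->
  exists l, [/\ adv_index w l, (flab F u < l)%N &
    (reserve w F u <= (count (fun i => adv_index w i && (l < i)%N) (iota 1 (size w))).+1)%N].
Proof.
rewrite /reserve -has_count => /hasP[i0 _ hi0].
have ex : exists i, adv_index w i && (flab F u < i)%N by exists i0.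
case: (ex_minnP ex) => l /andP[advl ul] min_l; exists l; split=> //.
set s := iota _ _; set a := (X in (_ <= (count X _).+1)%N).
have sub : subpred (fun i => adv_index w i && (flab F u < i)%N) (predU a (pred1 l)).
  move=> i hi; rewrite /= /a; case/andP: (hi) => -> _ /=.
  by have := min_l i hi; rewrite leq_eqVlt eq_sym orbC.
apply: leq_trans (sub_count sub s) _.
have := count_predUI a (pred1 l) s.
rewrite (count_uniq_mem l (iota_uniq _ _)) => e.
have : (l \in s <= 1)%N by case: (_ \in _).
by rewrite /s in e *; lia.
Qed.

(** Below full length the gap is positive, so nonnegative reach forces positive reserve. One more
    edge trades a unit of reserve for a unit of gap, and the new vertex lies on this tine only. *)
Lemma reach_pair_extend m w F u v : is_fork w F -> reach_pair m w F u v ->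
  (depth F u < height F)%N ->
  exists F' u', [/\ is_fork w F', reach_pair m w F' u' v, height F' = height F,
    depth F' u' = (depth F u).+1 & depth F' v = depth F v].
Proof.
move=> fF [uF vF uv ru rv] lt.
have res_gt0 : (0 < reserve w F u)%N by move: ru; rewrite /reach /gap; lia.
have [l [advl ul resl]] := next_adv_index res_gt0.
set F' := add_leaf F u l; set z := (fsz F).+1.
have zl : flab F' z = l by rewrite /F' /= eqxx.
have hF' : height F' = height F by exact: (add_leaf_height l fF uF lt).
exists F', z; split.
- exact: add_leaf_fork.
- split.
  + by rewrite /z ltnS.
  + exact: leqW.
  + apply/disjoint_overP => c; rewrite (add_leaf_anc_new l fF uF) (add_leaf_anc l fF uF vF).
    rewrite inE => /orP[/eqP->|cu] cv.
      by have := anc_le (fork_par_lt fF) vF cv; rewrite /z; lia.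
    have cF := leq_trans (anc_le (fork_par_lt fF) uF cu) uF.
    by rewrite add_leaf_flab //; apply: (disjoint_overP _ _ _ _ uv).
  + move: ru; rewrite /reach /gap hF' (add_leaf_depth_new l fF uF) /reserve zl.
    by move: resl; rewrite /reserve; lia.
  + by move: rv; rewrite /reach /gap hF' (add_leaf_depth l fF uF vF) /reserve add_leaf_flab.
- by [].
- exact: (add_leaf_depth_new l fF uF).
- exact: (add_leaf_depth l fF uF vF).
Qed.

Lemma reach_pair_balanced m w F u v : is_fork w F -> reach_pair m w F u v ->
  exists F', is_fork w F' /\ exists u v,
    [/\ (u <= fsz F')%N, (v <= fsz F')%N, disjoint_over m F' u v,
        depth F' u = height F' & depth F' v = height F'].
Proof.
(* Induction on the sum of the two gaps, which each extension lowers by one. *)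
have [n] := ubnP ((height F - depth F u) + (height F - depth F v)).
elim: n F u v => // n IH F u v lt_n fF uv.
have [uF vF duv _ _] := uv.
have := depth_le_height uF; rewrite leq_eqVlt => /orP[/eqP eu|lt]; last first.
  have [F' [u' [fF' uv' hF' du' dv']]] := reach_pair_extend fF uv lt.
  by apply: (IH F' u' v) => //; rewrite hF' du' dv'; lia.
have := depth_le_height vF; rewrite leq_eqVlt => /orP[/eqP ev|lt]; last first.
  have [F' [v' [fF' uv' hF' du' dv']]] := reach_pair_extend fF (reach_pairC uv) lt.
  by apply: (IH F' v' u) => //; rewrite hF' du' dv'; lia.
by exists F; split=> //; exists u, v.
Qed.

(** * Deleting an adversarial leaf *)

(** Vertices above [z] move down by one; [bump z] embeds the new numbers into the old ones, and
    [unbump z] inverts it away from [z]. *)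
Definition del_leaf (F : fork) (z : nat) : fork :=
  Fork (fsz F).-1 (fun i => unbump z (fpar F (bump z i)))
       (fun i => flab F (bump z i)).

Section DelLeaf.
Local Open Scope nat_scope.
Variables (w : seq bool) (F : fork) (z : nat).
Hypotheses (forkF : is_fork w F) (z_gt0 : 0 < z) (leafz : is_leaf F z).
Local Notation F' := (del_leaf F z).

Lemma leaf_le : z <= fsz F.
Proof. by case/andP: leafz. Qed.
Let zF := leaf_le.

Lemma leaf_neq_par v : 0 < v <= fsz F -> fpar F v != z.
Proof.
by case/andP: leafz => _ /hasPn H vF; apply: H; rewrite mem_iota add1n ltnS.
Qed.

Lemma bump_le v : v <= fsz F' -> bump z v <= fsz F.
Proof. by rewrite /= /bump; lia. Qed.

Lemma bump_pos v : 0 < v <= fsz F' -> 0 < bump z v <= fsz F.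
Proof. by rewrite /= /bump; lia. Qed.

Lemma bump_del_par v : 0 < v <= fsz F' -> bump z (fpar F' v) = fpar F (bump z v).
Proof. by move=> vF; rewrite /= unbumpK // inE leaf_neq_par // bump_pos. Qed.

Lemma bump_lt u v : (bump z u < bump z v) = (u < v).
Proof. by rewrite /bump; lia. Qed.

Lemma del_leaf_par_lt v : 0 < v <= fsz F' -> fpar F' v < v.
Proof.
move=> vF; rewrite -bump_lt bump_del_par //.
by apply: (fork_par_lt forkF); apply: bump_pos.
Qed.

Lemma bump0 : bump z 0 = 0.
Proof. by rewrite /bump leqNgt z_gt0. Qed.

Lemma del_leaf_depth v : v <= fsz F' -> depth F' v = depth F (bump z v).
Proof.
elim/ltn_ind: v => -[|v] IH vF; first by rewrite bump0.
have vF' : 0 < v.+1 <= fsz F' by [].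
have lt := del_leaf_par_lt vF'.
rewrite (depth_par del_leaf_par_lt vF') (depth_par (fork_par_lt forkF) (bump_pos vF')).
by rewrite IH ?bump_del_par //; apply: leq_trans (ltnW lt) vF.
Qed.

Lemma del_leaf_anc v c : v <= fsz F' -> (c \in anc F' v) = (bump z c \in anc F (bump z v)).
Proof.
have inj : injective (bump z) := can_inj (bumpK z).
elim/ltn_ind: v => -[|v] IH vF.
  by rewrite bump0 /anc /= !inE -(inj_eq inj) bump0.
have vF' : 0 < v.+1 <= fsz F' by [].
have lt := del_leaf_par_lt vF'.
rewrite (anc_par del_leaf_par_lt vF') (anc_par (fork_par_lt forkF) (bump_pos vF')).
rewrite !inE (inj_eq inj) IH ?bump_del_par //; exact: leq_trans (ltnW lt) vF.
Qed.

Lemma del_leaf_height : height F' <= height F.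
Proof.
apply: height_leP => v vF; rewrite del_leaf_depth //.
exact/depth_le_height/bump_le.
Qed.

Lemma del_leaf_fork : ~~ hon_index w (flab F z) -> is_fork w F'.
Proof.
move=> nhon; case: (forkF) => H0 H1 H2 H3; split.
- by rewrite -[RHS]H0 -[in RHS]bump0.
- move=> v vF; split; first exact: del_leaf_par_lt.
    by have [_ lt _] := H1 _ (bump_pos vF); rewrite -bump_del_par in lt.
  by have [] := H1 _ (bump_pos vF).
- move=> i hi; rewrite -[RHS](H2 i hi).
  have perm : perm_eq (iota 0 (fsz F).+1) (z :: map (bump z) (iota 0 (fsz F))).
    apply: uniq_perm; first exact: iota_uniq.
      rewrite /= map_inj_uniq ?iota_uniq ?andbT; last exact: (can_inj (bumpK z)).
      by apply/mapP => -[c _]; rewrite /bump; lia.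
    move=> c; rewrite mem_iota inE; case: (eqVneq c z) => [->|cz] /=.
      by rewrite ltnS zF.
    have ec : bump z (unbump z c) = c by rewrite unbumpK.
    rewrite -[in RHS]ec mem_map; last exact: (can_inj (bumpK z)).
    by rewrite mem_iota /unbump; lia.
  rewrite (permP perm) [fsz F']/= prednK; last by lia.
  rewrite [RHS]/= count_map.
  have /negbTE-> // : flab F z != i by apply: contraNneq nhon => ->.
- move=> a b aF bF; rewrite !del_leaf_depth //; apply: H3; exact: bump_le.
Qed.

Lemma del_leaf_reach v : v <= fsz F' -> (reach w F (bump z v) <= reach w F' v)%R.
Proof.
move=> vF; have := del_leaf_height.
by rewrite /reach /gap del_leaf_depth // /reserve /=; lia.
Qed.

Lemma del_leaf_pair m u v : u != z -> v != z -> reach_pair m w F u v ->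
  reach_pair m w F' (unbump z u) (unbump z v).
Proof.
move=> uz vz [uF vF duv ru rv].
have eu : bump z (unbump z u) = u by rewrite unbumpK.
have ev : bump z (unbump z v) = v by rewrite unbumpK.
have uF' : unbump z u <= fsz F' by rewrite /= /unbump; lia.
have vF' : unbump z v <= fsz F' by rewrite /= /unbump; lia.
split=> //.
- apply/disjoint_overP => c; rewrite !del_leaf_anc // eu ev /=.
  exact: (disjoint_overP _ _ _ _ duv).
- by apply: le_trans (del_leaf_reach uF'); rewrite eu.
- by apply: le_trans (del_leaf_reach vF'); rewrite ev.
Qed.

End DelLeaf.

Lemma reach_pair_par m w F u v : is_fork w F -> (0 < u)%N ->
  adv_index w (flab F u) -> reach_pair m w F u v -> reach_pair m w F (fpar F u) v.
Proof.
move=> fF u_gt0 advu [uF vF duv ru rv].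
have uF' : (0 < u <= fsz F)%N by rewrite u_gt0.
split=> //.
- by apply: leq_trans uF; apply/ltnW/(fork_par_lt fF).
- apply/disjoint_overP => c cu; apply: (disjoint_overP _ _ _ _ duv).
  exact: (sub_anc_par (fork_par_lt fF) uF').
- exact: le_trans ru (reach_par fF uF' advu).
Qed.

(** Induction on the size of the fork: tines ending at an adversarial leaf first retreat to its
    parent, then the leaf is deleted. *)
Lemma reach_pair_closed m w F u v : is_fork w F -> reach_pair m w F u v ->
  exists F', closed_fork w F' /\ exists u v, reach_pair m w F' u v.
Proof.
have [n] := ubnP (fsz F); elim: n F u v => // n IH F u v lt_n fF uv.
have [cl|] := pselect (forall z, is_leaf F z -> honest_vertex w F z).
  by exists F; split=> //; exists u, v.
move=> /existsNP[z /not_implyP[leafz /negP]].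
rewrite /honest_vertex negb_or -lt0n => /andP[z_gt0 nhon].
have zF := leaf_le leafz.
have zF' : (0 < z <= fsz F)%N by rewrite z_gt0.
have advz : adv_index w (flab F z).
  have [_ /(_ z zF')[_ lt le] _ _] := fF.
  by rewrite adv_or_hon ?nhon // le andbT; apply: leq_trans lt.
have pz : fpar F z != z by rewrite neq_ltn (fork_par_lt fF).
wlog uz : u v uv / u != z.
  move=> H; have [eu|] := eqVneq u z; last exact: H uv.
  rewrite eu in uv; exact: (H _ v (reach_pair_par fF z_gt0 advz uv) pz).
wlog vz : v uv / v != z.
  move=> H; have [ev|] := eqVneq v z; last exact: H uv.
  rewrite ev in uv; apply: (H _ _ pz); apply: reach_pairC.
  exact: (reach_pair_par fF z_gt0 advz (reach_pairC uv)).
apply: (IH (del_leaf F z) _ _ _ (del_leaf_fork fF z_gt0 leafz nhon)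
  (del_leaf_pair fF z_gt0 leafz uz vz uv)).
by rewrite /=; lia.
Qed.

(** * Upper bounds for reach and margin *)

Lemma mu_rel_nonnegP x y : mu_rel_nonneg x y <->
  exists F, is_fork (x ++ y) F /\ exists u v, reach_pair (size x) (x ++ y) F u v.
Proof.
split=> [[F [[fF cF] /(mu_fork_ge0P _ fF) uv]]|[F [fF [u [v uv]]]]]; first by exists F.
have [F' [cF' uv']] := reach_pair_closed fF uv.
by exists F'; split=> //; apply/mu_fork_ge0P => //; case: cF'.
Qed.

(** Longest tines have gap 0, hence nonnegative reach; conversely, both tines can be extended to
    full length. *)
Lemma balanced_mu_rel_nonneg x y : has_balanced_fork x y <-> mu_rel_nonneg x y.
Proof.
rewrite mu_rel_nonnegP; split=> -[F [fF [u [v]]]]; last exact: reach_pair_balanced.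
case=> uF vF duv eu ev; exists F; split=> //; exists u, v; split=> //.
  by rewrite /reach /gap eu subrr subr0.
by rewrite /reach /gap ev subrr subr0.
Qed.

Definition rho_step (r : nat) (b : bool) : nat := if b then r.+1 else r.-1.

Definition rho (w : seq bool) : nat := foldl rho_step 0%N w.

Definition margin_step (s : nat * int) (b : bool) : nat * int :=
  (rho_step s.1 b,
   if b then s.2 + 1 else if (s.2 == 0) && (0 < s.1)%N then 0 else s.2 - 1).

(** Before [y] is read a tine may be paired with itself, so the margin starts at the reach of
    [x]. *)
Definition margin_state (x y : seq bool) : nat * int :=
  foldl margin_step (rho x, (rho x)%:Z) y.

Lemma rho_rcons w b : rho (rcons w b) = rho_step (rho w) b.
Proof. exact: foldl_rcons. Qed.

Lemma margin_state_rcons x y b :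
  margin_state x (rcons y b) = margin_step (margin_state x y) b.
Proof. exact: foldl_rcons. Qed.

Lemma margin_state_rho x y : (margin_state x y).1 = rho (x ++ y).
Proof.
elim/last_ind: y => [|y b IH]; first by rewrite cats0.
by rewrite margin_state_rcons -rcons_cat rho_rcons -IH.
Qed.

(** Excludes states with reach 0 and positive margin from [potential_step]. The margin resists a 0
    only at value 0 with positive reach, where the new reach is still at least 0. *)
Lemma margin_state_le x y : (margin_state x y).2 <= (margin_state x y).1%:Z.
Proof.
elim/last_ind: y => [|y b IH] //.
rewrite margin_state_rcons.
move: (margin_state x y) IH => [r mu] /=; rewrite /rho_step.
by case: b => /=; [lia | case: ifP => _; lia].
Qed.

(** * Reach along the prefixes of the string *)

Section PrefixReach.
Variables (w : seq bool) (F : fork).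
Hypothesis forkF : is_fork w F.

(** The height left after trimming adversarial leaves from the part of the fork with labels at most
    [n]. *)
Definition hon_height (n : nat) : nat :=
  \max_(v < (fsz F).+1 | honest_vertex w F v && (flab F v <= n)%N) depth F v.

(* Reach with respect to the labels [<= n]; the largest honest depth stands in
   for the height, so that no prefix of the fork has to be closed. *)
Definition prefix_reach (n v : nat) : int :=
  (adv_upto w n)%:Z - (adv_upto w (flab F v))%:Z - (hon_height n)%:Z + (depth F v)%:Z.

Lemma hon_height_ge n v : (v <= fsz F)%N -> honest_vertex w F v ->
  (flab F v <= n)%N -> (depth F v <= hon_height n)%N.
Proof.
move=> vF hv vn.
have := @leq_bigmax_cond _ (fun v : 'I_(fsz F).+1 => honest_vertex w F v && (flab F v <= n)%N)
  (fun v : 'I__ => depth F v) (Ordinal (vF : (v < (fsz F).+1)%N)).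
by apply; rewrite hv.
Qed.

Lemma hon_height_leP n b :
  (forall v, (v <= fsz F)%N -> honest_vertex w F v -> (flab F v <= n)%N ->
    (depth F v <= b)%N) -> (hon_height n <= b)%N.
Proof.
by move=> H; apply/bigmax_leqP => v /andP[hv vn]; apply: H => //; rewrite -ltnS.
Qed.

Lemma hon_height_mono m n : (m <= n)%N -> (hon_height m <= hon_height n)%N.
Proof.
move=> mn; apply: hon_height_leP => v vF hv vm.
by apply: hon_height_ge => //; apply: leq_trans mn.
Qed.

Lemma hon_height_height n : (hon_height n <= height F)%N.
Proof. by apply: hon_height_leP => v vF _ _; apply: depth_le_height. Qed.

Lemma hon_height_lt n v : (v <= fsz F)%N -> flab F v = n.+1 ->
  hon_index w n.+1 -> (hon_height n < depth F v)%N.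
Proof.
have [H0 _ _ H3] := forkF.
move=> vF vn hn; have v_gt0 : (0 < v)%N by case: v vn {vF} => //; rewrite H0.
have d_gt0 : (0 < depth F v)%N by rewrite (depth_par (fork_par_lt forkF)) ?v_gt0.
(* (F4) compares honest indices only; the root, labeled 0, is settled by its depth 0. *)
rewrite -(prednK d_gt0) ltnS; apply: hon_height_leP => -[|u] uF hu un.
  by rewrite /depth.
rewrite -ltnS prednK //; apply: H3 => //; first by rewrite vn.
by rewrite vn ltnS.
Qed.

(** Old tines gain at most one. A tine ending at the new index has no reserve and is one edge longer
    than its parent tine, whose reserve is nonnegative, so there the parent serves as [v']. *)
Lemma prefix_reach_adv n v : adv_index w n.+1 -> (v <= fsz F)%N ->
  (flab F v <= n.+1)%N ->
  exists v', [/\ (v' <= fsz F)%N, (flab F v' <= n)%N,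
    {subset anc F v' <= anc F v} & prefix_reach n.+1 v <= prefix_reach n v' + 1].
Proof.
move=> advn vF; have hmon := hon_height_mono (leqnSn n).
have eA := adv_uptoS w n; rewrite advn in eA.
rewrite leq_eqVlt => /orP[/eqP vn|vn]; last first.
  by exists v; split=> //; rewrite /prefix_reach; lia.
have [H0 H1 _ _] := forkF.
have v_gt0 : (0 < v <= fsz F)%N by rewrite vF; case: v vn {vF} => //; rewrite H0.
have [p_lt lab_lt _] := H1 _ v_gt0.
exists (fpar F v); split.
- exact: leq_trans (ltnW p_lt) vF.
- by rewrite -ltnS -vn.
- exact: (sub_anc_par (fork_par_lt forkF)).
- have le : (flab F (fpar F v) <= n)%N by rewrite -ltnS -vn.
  have := adv_upto_le w le.
  rewrite /prefix_reach vn (depth_par (fork_par_lt forkF) v_gt0); lia.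
Qed.

Lemma hon_vertex_ex i : hon_index w i -> exists2 v, (v <= fsz F)%N & flab F v = i.
Proof.
have [_ _ H2 _] := forkF.
move=> /H2 e; have : has (fun v => flab F v == i) (iota 0 (fsz F).+1).
  by rewrite has_count e.
by case/hasP => v; rewrite mem_iota => vF /eqP vi; exists v.
Qed.

(** The new honest vertex is deeper than all earlier honest ones, so the honest height rises while
    no reserve is gained. *)
Lemma prefix_reach_hon n v : hon_index w n.+1 ->
  prefix_reach n.+1 v <= prefix_reach n v - 1.
Proof.
move=> hn; have [u uF un] := hon_vertex_ex hn.
have lt := hon_height_lt uF un hn.
have : (depth F u <= hon_height n.+1)%N.
  by apply: hon_height_ge; rewrite // ?un // /honest_vertex un hn orbT.
have := adv_uptoS w n; case/andP: (hn) => hn1 hn2.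
by rewrite adv_or_hon // hn addn0 /prefix_reach; lia.
Qed.

(** The new vertex has no reserve and is no deeper than the honest height. Being deeper than all
    earlier honest vertices, it has a parent at least as deep as each of them. *)
Lemma prefix_reach_new n v : hon_index w n.+1 -> (v <= fsz F)%N ->
  flab F v = n.+1 ->
  [/\ prefix_reach n.+1 v <= 0, (0 < v)%N, (flab F (fpar F v) <= n)%N
    & 0 <= prefix_reach n (fpar F v)].
Proof.
move=> hn vF vn; have [H0 H1 _ _] := forkF.
have v_gt0 : (0 < v <= fsz F)%N by rewrite vF; case: v vn {vF} => //; rewrite H0.
have [p_lt lab_lt _] := H1 _ v_gt0; rewrite vn ltnS in lab_lt.
have lt := hon_height_lt vF vn hn.
have : (depth F v <= hon_height n.+1)%N.
  by apply: hon_height_ge; rewrite // ?vn // /honest_vertex vn hn orbT.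
have := adv_upto_le w lab_lt.
rewrite /prefix_reach vn (depth_par (fork_par_lt forkF) v_gt0) in lt *.
by move=> A1 A2; split=> //; [lia | case/andP: v_gt0 | lia].
Qed.

Lemma prefix_reach_rho n v : (n <= size w)%N -> (v <= fsz F)%N ->
  (flab F v <= n)%N -> prefix_reach n v <= (rho (take n w))%:Z.
Proof.
elim: n v => [|n IH] v nw vF vn.
  have [H0 H1 _ _] := forkF.
  have -> : v = 0%N.
    case: v vF vn => // v vF; have [_ + _] := H1 v.+1 vF.
    by move=> lt; rewrite leqn0 => /eqP e; rewrite e in lt.
  by rewrite /prefix_reach take0 H0 /depth /=; lia.
rewrite (take_nth false nw) rho_rcons.
case en : (nth false w n).
  have advn : adv_index w n.+1 by rewrite /adv_index /= nw en.
  have [v' [v'F v'n _ le]] := prefix_reach_adv advn vF vn.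
  by have := IH v' (ltnW nw) v'F v'n; rewrite /=; lia.
have hn : hon_index w n.+1 by rewrite /hon_index /= nw en.
(* The tine at the new honest vertex has reach at most 0, which fits the truncation of [rho] at 0;
   older tines lose at least one. *)
move: vn; rewrite leq_eqVlt => /orP[/eqP vn|vn].
  by have [le _ _ _] := prefix_reach_new hn vF vn; apply: le_trans le _.
have le := prefix_reach_hon v hn.
by have := IH v (ltnW nw) vF vn; rewrite /=; lia.
Qed.

Lemma disjoint_sub m u v u' v' : {subset anc F u' <= anc F u} ->
  {subset anc F v' <= anc F v} -> disjoint_over m F u v -> disjoint_over m F u' v'.
Proof.
by move=> su sv /disjoint_overP d; apply/disjoint_overP => c /su cu /sv cv; apply: d.
Qed.

(* The tine ending at the new honest vertex [u] has a parent of nonnegative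
   reach, so the induction hypothesis applied to that parent and [v] bounds
   the reach of [v]. *)
Lemma margin_new_hon m n u v (s : nat * int) : hon_index w n.+1 -> (m <= n)%N ->
  (forall v, (v <= fsz F)%N -> (flab F v <= n)%N -> prefix_reach n v <= s.1%:Z) ->
  (forall u v, (u <= fsz F)%N -> (v <= fsz F)%N -> (flab F u <= n)%N ->
    (flab F v <= n)%N -> disjoint_over m F u v ->
    Num.min (prefix_reach n u) (prefix_reach n v) <= s.2) ->
  (u <= fsz F)%N -> (v <= fsz F)%N -> flab F u = n.+1 -> (flab F v <= n.+1)%N ->
  disjoint_over m F u v ->
  Num.min (prefix_reach n.+1 u) (prefix_reach n.+1 v) <= (margin_step s false).2.
Proof.
move=> hn mn Hr Hm uF vF un vn duv.
(* Two tines ending at the new honest index coincide and share its edge, whose label exceeds [m]. *)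
move: vn; rewrite leq_eqVlt => /orP[/eqP vn|].
  have e : u = v by apply: (hon_label_inj forkF) => //; rewrite ?un ?vn.
  have := disjoint_overP _ _ _ _ duv u (anc_refl (fork_par_lt forkF) uF).
  by rewrite -e un => /(_ (anc_refl (fork_par_lt forkF) uF)); lia.
rewrite ltnS => vn.
have [u_le u_gt0 pn p_ge] := prefix_reach_new hn uF un.
have uF' : (0 < u <= fsz F)%N by rewrite u_gt0.
have pF : (fpar F u <= fsz F)%N by apply: leq_trans uF; apply/ltnW/(fork_par_lt forkF).
have dpv : disjoint_over m F (fpar F u) v.
  by apply: disjoint_sub duv => //; apply: (sub_anc_par (fork_par_lt forkF)).
have := Hm _ _ pF vF pn vn dpv; have := Hr _ vF vn.
have := prefix_reach_hon v hn.
rewrite /margin_step /= !ge_min.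
case: ifP => [_ _ _ _|]; first by rewrite u_le.
(* The parent has nonnegative reach, so a negative bound on the minimum must hold for [v]. *)
move=> cond le1 le2 le3; have {le3} : s.2 < 0 -> prefix_reach n v <= s.2.
  by case/orP: le3 => //; lia.
(* A negative margin bounds [v]; for a positive one the reach of [u], at most 0, is small enough; at
   margin 0 the excluded exception leaves [s.1 = 0], which bounds [v]. *)
move: cond; case: (ltgtP s.2 0) => /= [neg|pos|->] cond le3; apply/orP.
- by right; have := le3 isT; lia.
- by left; lia.
- by right; lia.
Qed.

End PrefixReach.

(** Induction along [y]. After a 1 both tines are traced back to older ones, still disjoint, with
    reach lower by at most one; after a 0 either some tine ends at the new honest vertex or both
    lose at least one. *)
Lemma prefix_reach_margin x y F : is_fork (x ++ y) F -> forall j u v,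
  (j <= size y)%N -> (u <= fsz F)%N -> (v <= fsz F)%N ->
  (flab F u <= size x + j)%N -> (flab F v <= size x + j)%N ->
  disjoint_over (size x) F u v ->
  Num.min (prefix_reach (x ++ y) F (size x + j) u) (prefix_reach (x ++ y) F (size x + j) v)
    <= (margin_state x (take j y)).2.
Proof.
move=> fF; set w := x ++ y in fF *; set m := size x.
have rhoE j v : (j <= size y)%N -> (v <= fsz F)%N -> (flab F v <= m + j)%N ->
    prefix_reach w F (m + j) v <= (margin_state x (take j y)).1%:Z.
  move=> jy vF vj; have -> : (margin_state x (take j y)).1 = rho (take (m + j) w).
    by rewrite margin_state_rho /w take_cat ltnNge leq_addr addKn.
  by apply: (prefix_reach_rho fF) => //; rewrite /w size_cat leq_add2l.
elim=> [|j IH] u v jy uF vF un vn duv.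
  have := rhoE 0%N u isT uF un; have := rhoE 0%N v isT vF vn.
  by rewrite take0 /margin_state /= ge_min => _ ->.
have nw : (m + j < size w)%N by rewrite /w size_cat ltn_add2l.
have enth : nth false w (m + j) = nth false y j.
  by rewrite /w nth_cat ltnNge leq_addr addKn.
rewrite (take_nth false jy) margin_state_rcons.
rewrite addnS in un vn *.
case en : (nth false y j).
  have advn : adv_index w (m + j).+1 by rewrite /adv_index /= nw enth en.
  have [u' [u'F u'n su leu]] := prefix_reach_adv fF advn uF un.
  have [v' [v'F v'n sv lev]] := prefix_reach_adv fF advn vF vn.
  have := IH u' v' (ltnW jy) u'F v'F u'n v'n (disjoint_sub su sv duv).
  by rewrite /= !ge_min => /orP[le|le]; apply/orP; [left|right]; lia.
have hn : hon_index w (m + j).+1 by rewrite /hon_index /= nw enth en.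
have Hr v0 := @rhoE j v0 (ltnW jy).
have Hm u0 v0 := IH u0 v0 (ltnW jy).
have [eu|neu] := eqVneq (flab F u) (m + j).+1.
  exact: (margin_new_hon fF hn (leq_addr _ _) Hr Hm).
have [ev|nev] := eqVneq (flab F v) (m + j).+1.
  rewrite minC; apply: (margin_new_hon fF hn (leq_addr _ _) Hr Hm) => //.
  by rewrite disjoint_overC.
have {}un : (flab F u <= m + j)%N by lia.
have {}vn : (flab F v <= m + j)%N by lia.
have := Hm u v uF vF un vn duv.
have := prefix_reach_hon fF u hn; have := prefix_reach_hon fF v hn.
rewrite /= !ge_min => le1 le2 /orP[le|le]; apply/orP; [left|right];
  by case: ifP => cond; lia.
Qed.

Lemma mu_rel_nonneg_margin x y : mu_rel_nonneg x y -> 0 <= (margin_state x y).2.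
Proof.
case/mu_rel_nonnegP => F [fF [u [v [uF vF duv ru rv]]]].
have ul := flab_le fF uF; have vl := flab_le fF vF.
have reachE t : (t <= fsz F)%N -> reach (x ++ y) F t <= prefix_reach (x ++ y) F (size (x ++ y)) t.
  move=> tF; have := reserve_adv_upto (flab_le fF tF).
  have := hon_height_height (x ++ y) F (size (x ++ y)).
  by rewrite /reach /gap /prefix_reach; lia.
have := prefix_reach_margin fF (leqnn _) uF vF.
rewrite -size_cat take_size => /(_ ul vl duv); apply: le_trans.
by rewrite le_min (le_trans ru (reachE _ uF)) (le_trans rv (reachE _ vF)).
Qed.

(** * The exponential supermartingale *)

Definition prefix_expect (R : realType) (T : nat) (p : T.-tuple bool -> R)
    (G : seq bool -> R) (t : nat) : R :=
  \sum_(w : T.-tuple bool) p w * G (take t w).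

(** Given the prefix, the mean of [G] increases with the probability of a 1, since [G] is larger
    there; the extreme probability [(1 - eps) / 2] is thus the worst case. *)
Lemma prefix_expect_step (R : realType) (eps : R) (T : nat) (p : T.-tuple bool -> R)
    (G K : seq bool -> R) (t : nat) :
  (t < T)%N -> is_distribution p -> martingale_cond eps p ->
  (forall s, size s = t -> G (rcons s false) <= G (rcons s true)) ->
  (forall s, size s = t ->
    (1 - eps) / 2 * G (rcons s true) + (1 + eps) / 2 * G (rcons s false) <= K s) ->
  prefix_expect p G t.+1 <= prefix_expect p K t.
Proof.
move=> tT [p_ge0 _] mart mono step.
have sz (w : T.-tuple bool) : size (take t w) = t.
  by rewrite size_takel // size_tuple ltnW.
(* Tuples provide a finite type to partition over; the default never occurs, as [take t w] has size
   [t]. *)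
pose prefix (w : T.-tuple bool) : t.-tuple bool := insubd [tuple of nseq t false] (take t w).
have prefixE w (s : t.-tuple bool) : (prefix w == s) = (take t w == s).
  by rewrite -val_eqE /prefix val_insubd sz eqxx.
rewrite /prefix_expect (partition_big prefix xpredT) //= [leRHS](partition_big prefix xpredT) //=.
apply: ler_sum => s _; under eq_bigl do rewrite prefixE; under [leRHS]eq_bigl do rewrite prefixE.
have s_size : size s = t by rewrite size_tuple.
set S := \sum_(w : T.-tuple bool | take t w == s) p w.
have S_ge0 : 0 <= S by apply: sumr_ge0.
have -> : \sum_(w : T.-tuple bool | take t w == s) p w * K (take t w) = S * K s.
  by rewrite mulr_suml; apply: eq_bigr => w /eqP->.
have takeS (w : T.-tuple bool) : take t.+1 w = rcons (take t w) (nth false w t).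
  by apply: take_nth; rewrite size_tuple.
rewrite (bigID (fun w : T.-tuple bool => nth false w t)) /=.
have {}mart := mart t s tT s_size.
have SE : S = \sum_(w : T.-tuple bool | (take t w == s) && nth false w t) p w +
    \sum_(w : T.-tuple bool | (take t w == s) && ~~ nth false w t) p w.
  by rewrite /S (bigID (fun w : T.-tuple bool => nth false w t)).
have -> : \sum_(w : T.-tuple bool | (take t w == s) && nth false w t) p w * G (take t.+1 w)
   = (\sum_(w : T.-tuple bool | (take t w == s) && nth false w t) p w) * G (rcons s true).
  by rewrite mulr_suml; apply: eq_bigr => w /andP[/eqP es en]; rewrite takeS es en.
have -> : \sum_(w : T.-tuple bool | (take t w == s) && ~~ nth false w t) p w * G (take t.+1 w)
   = (\sum_(w : T.-tuple bool | (take t w == s) && ~~ nth false w t) p w) * G (rcons s false).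
  by rewrite mulr_suml; apply: eq_bigr => w /andP[/eqP es /negbTE en]; rewrite takeS es en.
rewrite -/S in mart.
move: mart SE.
set S1 := \sum_(w | _ && nth _ _ _) _; set S0 := \sum_(w | _ && ~~ _) _ => mart SE.
have -> : S0 = S - S1 by rewrite SE addrC addKr.
have step' := ler_wpM2l S_ge0 (step s s_size).
have dG : 0 <= G (rcons s true) - G (rcons s false) by rewrite subr_ge0 mono.
have := ler_wpM2r dG mart.
by lra.
Qed.

(** * Drift of the potential *)

Definition neg_part (m : int) : nat := if m is Negz n then n.+1 else 0%N.

Lemma neg_part_anti m n : m <= n -> (neg_part n <= neg_part m)%N.
Proof. by case: m n => [m|m] [n|n] //=; lia. Qed.

(* Here [u] is 1 / b.  Ignoring [mu] while it is positive is what gives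
   [potential_step] in every state: for [mu >= 0] only the drift of [rho] is
   available, at the reflecting state [rho = 0] only that of [mu]. *)
Definition potential (R : realType) (a u : R) (s : nat * int) : R :=
  a ^+ s.1 * u ^+ neg_part s.2.

Lemma rho_weight_mono (R : realType) (a : R) r : 1 <= a ->
  a ^+ rho_step r false <= a ^+ rho_step r true.
Proof. by move=> a_ge1; rewrite ler_weXn2l //= (leq_trans (leq_pred _)). Qed.

Lemma potential_mono (R : realType) (a u : R) s : 1 <= a -> 0 <= u <= 1 ->
  potential a u (margin_step s false) <= potential a u (margin_step s true).
Proof.
move=> a_ge1 /andP[u_ge0 u_le1]; have a_ge0 : 0 <= a := le_trans ler01 a_ge1.
apply: ler_pM; rewrite ?exprn_ge0 //; first exact: rho_weight_mono.
apply: ler_wiXn2l => //.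
by apply: neg_part_anti; rewrite /margin_step /=; case: ifP; lia.
Qed.

Section Potential.
Variables (R : realType) (p q a u th : R).
Hypotheses (p_ge0 : 0 <= p) (q_ge0 : 0 <= q) (pq : p + q = 1).
Hypotheses (a_ge1 : 1 <= a) (u_gt0 : 0 < u) (u_le1 : u <= 1) (th_ge0 : 0 <= th).
Hypotheses (Ha : p * a + q * a^-1 <= th) (Hu : p * (a * u^-1) + q * u <= th).

Let a_gt0 : 0 < a. Proof. exact: lt_le_trans a_ge1. Qed.
Let aX_ge0 n : 0 <= a ^+ n. Proof. by rewrite exprn_ge0 // ltW. Qed.
Let uX_ge0 n : 0 <= u ^+ n. Proof. by rewrite exprn_ge0 // ltW. Qed.

Lemma expr_step r : p * a ^+ r.+2 + q * a ^+ r <= th * a ^+ r.+1.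
Proof.
have -> : p * a ^+ r.+2 + q * a ^+ r = (p * a + q * a^-1) * a ^+ r.+1.
  by rewrite !exprS; field; rewrite gt_eqF.
by rewrite ler_wpM2r.
Qed.

(** Reflection at 0 breaks the contraction; there the left side is at most [a], which the additive
    term absorbs. *)
Lemma rho_weight_step r :
  p * a ^+ rho_step r true + q * a ^+ rho_step r false <= th * a ^+ r + a.
Proof.
case: r => [|r] /=.
  rewrite expr1 expr0 !mulr1; apply: (@le_trans _ _ a); last by rewrite lerDr.
  by rewrite -[leRHS]mul1r -pq mulrDl lerD2l ler_peMr.
by rewrite -[leLHS]addr0 lerD ?expr_step // ltW.
Qed.

Lemma potential_step (s : nat * int) : s.2 <= s.1%:Z ->
  p * potential a u (margin_step s true) + q * potential a u (margin_step s false)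
    <= th * potential a u s.
Proof.
have pu : p * a <= p * (a * u^-1).
  by rewrite ler_wpM2l // ler_peMr ?(ltW a_gt0) // invf_ge1.
case: s => r [[|m]|n] le; rewrite /potential /margin_step /=.
(* Margin 0: with positive reach the factor in [u] stays 1 and the drift of the reach decides; with
   reach 0, [Hu] weakened by dropping [u^-1] is enough. *)
- case: r le => [|r] _ /=; last by rewrite !expr0 !mulr1 expr_step.
  rewrite !expr0 !expr1 !mulr1 mul1r; apply: le_trans Hu.
  by rewrite lerD2r.
- case: r le => [|r] /= le; first by lia.
  by rewrite !expr0 !mulr1 expr_step.
- have -> : neg_part (Negz n + 1) = n by case: n {le} => [|n]; rewrite /neg_part //=; lia.
  rewrite addn0.
  case: r {le} => [|r] /=.
    have -> : p * (a ^+ 1 * u ^+ n) + q * (a ^+ 0 * u ^+ n.+2) =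
        (p * (a * u^-1) + q * u) * u ^+ n.+1.
      by rewrite !exprS; field; rewrite gt_eqF.
    by rewrite expr0 mul1r ler_wpM2r.
  have -> : p * (a ^+ r.+2 * u ^+ n) + q * (a ^+ r * u ^+ n.+2) =
      (p * (a * u^-1) + q * u * a^-1) * (a ^+ r.+1 * u ^+ n.+1).
    by rewrite !exprS; field; rewrite !gt_eqF.
  (* A positive reach also falls on a 0, which only adds a factor [a^-1], at most 1, to the second
     term of [Hu]. *)
  rewrite ler_wpM2r ?mulr_ge0 //; apply: le_trans Hu; rewrite lerD2l.
  by rewrite ler_piMr ?invf_le1 ?mulr_ge0 // ltW.
Qed.

End Potential.

Lemma margin_tail (R : realType) (eps a u th : R) (T k : nat) (p : T.-tuple bool -> R) :
  0 < eps < 1 -> 1 <= a -> 0 < u <= 1 -> 0 <= th < 1 ->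
  (1 - eps) / 2 * a + (1 + eps) / 2 * a^-1 <= th ->
  (1 - eps) / 2 * (a * u^-1) + (1 + eps) / 2 * u <= th ->
  (k <= T)%N -> is_distribution p -> martingale_cond eps p ->
  Pr p (fun w => 0 <= (margin_state (take (T - k) w) (drop (T - k) w)).2)
    <= a / (1 - th) * th ^+ k.
Proof.
move=> /andP[eps_gt0 eps_lt1] a_ge1 /andP[u_gt0 u_le1] /andP[th_ge0 th_lt1] Ha Hu kT dp mart.
have [p_ge0 p_sum] := dp.
have p0 : 0 <= (1 - eps) / 2 by lra.
have q0 : 0 <= (1 + eps) / 2 by lra.
have pq : (1 - eps) / 2 + (1 + eps) / 2 = 1 by lra.
have th1 : 0 < 1 - th by lra.
(* The fixed point of [E -> th * E + a], the recursion bounding the expectation of [a ^+ rho]. *)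
set C := a / (1 - th).
have CE : th * C + a = C by rewrite /C; field; rewrite gt_eqF.
have rho_expect t : (t <= T)%N -> prefix_expect p (fun s => a ^+ rho s) t <= C.
  elim: t => [|t IH] tT.
    rewrite /prefix_expect; under eq_bigr do rewrite take0 expr0 mulr1.
    by rewrite p_sum /C ler_pdivlMr // mul1r; lra.
  have := prefix_expect_step (G := fun s => a ^+ rho s)
    (K := fun s => th * a ^+ rho s + a) tT dp mart.
  move=> /(_ _ _)/le_trans; apply.
  - by move=> s _; rewrite !rho_rcons; apply: rho_weight_mono.
  - by move=> s _; rewrite !rho_rcons; apply: rho_weight_step.
  rewrite /prefix_expect; under eq_bigr do rewrite mulrDr mulrCA.
  rewrite big_split /= -mulr_sumr -mulr_suml p_sum mul1r -[leRHS]CE lerD2r.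
  by rewrite ler_wpM2l //; apply: IH; apply: ltnW.
set m := (T - k)%N.
pose st s := margin_state (take m s) (drop m s).
have margin_expect j : (j <= k)%N ->
    prefix_expect p (fun s => potential a u (st s)) (m + j) <= C * th ^+ j.
  elim: j => [|j IH] jk.
    (* At the start of [y] the margin equals the reach, hence is nonnegative, and the potential is
       [a ^+ rho]. *)
    rewrite addn0 expr0 mulr1; apply: le_trans (rho_expect m (leq_subr _ _)).
    apply: ler_sum => w _; rewrite ler_wpM2l // /st take_takel //.
    by rewrite drop_oversize ?size_take_min ?geq_minl // /potential /= expr0 mulr1.
  rewrite addnS; have tT : (m + j < T)%N by rewrite /m; lia.
  have := prefix_expect_step (G := fun s => potential a u (st s))
    (K := fun s => th * potential a u (st s)) tT dp mart.
  have st_rcons s b : size s = (m + j)%N -> st (rcons s b) = margin_step (st s) b.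
    move=> ss; have ms : (m <= size s)%N by rewrite ss leq_addr.
    by rewrite /st -margin_state_rcons drop_rcons // -cats1 takel_cat.
  move=> /(_ _ _)/le_trans; apply.
  - by move=> s ss; rewrite !st_rcons //; apply: potential_mono; rewrite // (ltW u_gt0).
  - move=> s ss; rewrite !st_rcons //; apply: potential_step => //.
    exact: margin_state_le.
  rewrite /prefix_expect; under eq_bigr do rewrite mulrCA.
  by rewrite -mulr_sumr exprS mulrCA ler_wpM2l //; apply: IH; apply: ltnW.
(* Markov's inequality: the potential is at least 1 once the margin is nonnegative. *)
have := margin_expect k (leqnn _); apply: le_trans.
rewrite /Pr /prefix_expect subnK // big_mkcond; apply: ler_sum => w _.
have a_gt0 : 0 < a by lra.
have pot_ge0 s : 0 <= potential a u s by rewrite /potential mulr_ge0 // exprn_ge0 // ltW.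
case: asboolP => [mu_ge0|_]; last by rewrite mulr_ge0.
rewrite take_oversize ?size_tuple // ler_peMr // /potential /st.
case: (margin_state _ _) mu_ge0 => r [n|//] _ /=.
by rewrite expr0 mulr1 exprn_ege1.
Qed.

Theorem theorem4 (R : realType) (eps : R) :
  0 < eps < 1 ->
  exists c C : R, 0 < c /\ 0 < C /\
    forall (T k : nat) (p : T.-tuple bool -> R),
      (k <= T)%N -> is_distribution p -> martingale_cond eps p ->
      Pr p (fun w => has_balanced_fork (take (T - k) w) (drop (T - k) w))
        = Pr p (fun w => mu_rel_nonneg (take (T - k) w) (drop (T - k) w))
      /\ Pr p (fun w => mu_rel_nonneg (take (T - k) w) (drop (T - k) w))
        <= C * expR (- (c * k%:R)).
Proof.
move=> eps01; have /andP[eps_gt0 eps_lt1] := eps01.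
(* With [u = 1 - eps] the margin condition has left side a/2 + (1 - eps^2)/2 = 1 - eps^2/4. The
   reach condition has left side at most 1 - eps^3/2 + (1 + eps) eps^4/8. Both are at most
   [1 - c]. *)
pose c : R := eps ^+ 3 / 4; pose a : R := 1 + eps ^+ 2 / 2.
have e2_gt0 : 0 < eps ^+ 2 by rewrite exprn_gt0.
have e3_gt0 : 0 < eps ^+ 3 by rewrite exprn_gt0.
have e4E : eps ^+ 4 = eps * eps ^+ 3 by rewrite exprS.
have e3E : eps ^+ 3 = eps * eps ^+ 2 by rewrite exprS.
have e2E : eps ^+ 2 = eps * eps by rewrite expr2.
have c_gt0 : 0 < c by rewrite /c; lra.
have e3_lt : eps ^+ 3 <= eps ^+ 2 by rewrite e3E; nra.
have e2_lt : eps ^+ 2 <= 1 by rewrite e2E; nra.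
have c_lt1 : c < 1 by rewrite /c; lra.
have a_ge1 : 1 <= a by rewrite /a; lra.
exists c, (a / c); split=> //; split; first by rewrite divr_gt0 // (lt_le_trans _ a_ge1).
move=> T k p kT dp mart; split.
  by apply: eq_bigl => w; apply: asbool_equiv_eq; apply: balanced_mu_rel_nonneg.
have [p_ge0 _] := dp.
have tail : Pr p (fun w => mu_rel_nonneg (take (T - k) w) (drop (T - k) w))
    <= a / c * (1 - c) ^+ k.
  have := @margin_tail R eps a (1 - eps) (1 - c) T k p eps01 a_ge1.
  rewrite opprB addrCA subrr addr0 => tail.
  apply: le_trans (tail _ _ _ _ kT dp mart); last 4 first.
  - by lra.
  - by lra.
  - have a_gt0 : 0 < a by lra.
    (* Second-order expansion of 1/(1 + d) at d = eps^2/2, from (1 - d + d^2)(1 + d) = 1 + d^3. *)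
    have ainv : a^-1 <= 1 - eps ^+ 2 / 2 + eps ^+ 4 / 4.
      rewrite -div1r ler_pdivrMr // /a.
      have -> : (1 - eps ^+ 2 / 2 + eps ^+ 4 / 4) * (1 + eps ^+ 2 / 2) = 1 + eps ^+ 6 / 8.
        by field.
      by rewrite lerDl divr_ge0 // exprn_ge0 // ltW.
    apply: (@le_trans _ _ ((1 - eps) / 2 * a +
       (1 + eps) / 2 * (1 - eps ^+ 2 / 2 + eps ^+ 4 / 4))).
      by rewrite lerD2l ler_wpM2l //; lra.
    by rewrite /a /c; nra.
  - have -> : (1 - eps) / 2 * (a * (1 - eps)^-1) = a / 2 by field; rewrite gt_eqF //; lra.
    by rewrite /a /c; nra.
  rewrite /Pr big_mkcond [leRHS]big_mkcond; apply: ler_sum => w _.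
  case: asboolP => [/mu_rel_nonneg_margin mu|_]; last by case: asboolP.
  by case: asboolP.
apply: le_trans tail _; rewrite ler_wpM2l //.
  by rewrite divr_ge0 ?(ltW c_gt0) // (le_trans _ a_ge1).
rewrite -[- (c * _)]mulNr expRM_natr; apply: lerXn2r; rewrite ?nnegrE ?expR_ge0 //; first lra.
exact: expR_ge1Dx.
Qed.
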